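(* For every $\mu>0$ there exists a set $F_*\in\mathcal K$ with $|F_*|=\mu$ such that $P_S(F_* )\le P_S(F)$ for every $F\in\mathcal K$ with $|F|=\mu$.
   Context: Fix $n\ge 2$ and $s\in(0,1)$. Write $x=(x_1,x')\in\mathbb R\times\mathbb R^{n-1}$, $e_1=(1,0,\dots,0)$, and let $S:=[-1/2,1/2]\times\mathbb R^{n-1}$. Define the kernel $K(x):=\sum_{k\in\mathbb Z}|x+ke_1|^{-n-s}$ (with values in $(0,+\infty]$), and for a measurable $E\subseteq\mathbb R^n$ set $P_S(E):=\int_{E\cap S}\int_{S\setminus E}K(x-y)\,dx\,dy$. The class $\mathcal K$ consists of all sets $F=\{(x_1,x')\in S: |x'|\le f(x_1)\}$ where $f:[-1/2,1/2]\to[0,+\infty]$ is even and non-increasing on $[0,1/2]$. $|\cdot|$ denotes Lebesgue measure. *)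

(* Defs.v *)
From HB Require Import structures.
From mathcomp Require Import all_boot all_order all_algebra.
From mathcomp Require Import all_classical all_reals all_analysis.
Set Implicit Arguments. Unset Strict Implicit. Unset Printing Implicit Defensive.
Import Order.TTheory GRing.Theory Num.Theory.
Local Open Scope classical_set_scope.
Local Open Scope ring_scope.

Section Defs.
Variable R : realType.

(* Points of R^n are written x = (x_1, x') in R * 'rV[R]_(n.-1). *)
Definition pt (n : nat) := (R * 'rV[R]_(n.-1))%type.

Definition eucl (m : nat) (v : 'rV[R]_m) : R := Num.sqrt (\sum_i v 0 i ^+ 2).

Definition normpt (n : nat) (x : pt n) : R := Num.sqrt (x.1 ^+ 2 + eucl x.2 ^+ 2).

Definition ptsub (n : nat) (x y : pt n) : pt n := (x.1 - y.1, x.2 - y.2).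

Definition setc (m : nat) (v : 'rV[R]_m) (k : nat) (t : R) : 'rV[R]_m :=
  \row_j (if (j : nat) == k then t else v 0 j).

Fixpoint iint (m : nat) (k : nat) (f : 'rV[R]_m -> \bar R) (v : 'rV[R]_m) : \bar R :=
  match k with
  | 0 => f v
  | k'.+1 => (\int[@lebesgue_measure R]_t iint k' f (setc v k' t))%E
  end.

(* Lebesgue integral over R^m (Tonelli: iterated integrals) *)
Definition int_rV (m : nat) (f : 'rV[R]_m -> \bar R) : \bar R := iint m f 0.

Definition int_Rn (n : nat) (f : pt n -> \bar R) : \bar R :=
  (\int[@lebesgue_measure R]_t int_rV (fun v => f (t, v)))%E.

Definition leb (n : nat) (E : set (pt n)) : \bar R :=
  int_Rn (fun x => (\1_E x)%:E).

Definition strip (n : nat) : set (pt n) := [set x | -(2^-1) <= x.1 <= 2^-1].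

Definition Kern (n : nat) (s : R) (x : pt n) : \bar R :=
  (\esum_(k in [set: int])
     (let r := normpt ((x.1 + k%:~R)%R, x.2) in
      if (r == 0)%R then +oo else (r `^ (- (n%:R + s)%R))%:E))%E.

Definition PS (n : nat) (s : R) (E : set (pt n)) : \bar R :=
  int_Rn (fun y => ((\1_(E `&` @strip n) y)%:E *
     int_Rn (fun x => (\1_(@strip n `\` E) x)%:E * Kern s (ptsub x y)))%E).

Definition inK (n : nat) (F : set (pt n)) : Prop :=
  exists f : R -> \bar R,
    (forall t, -(2^-1) <= t <= 2^-1 -> (0 <= f t)%E) /\
    (forall t, -(2^-1) <= t <= 2^-1 -> f (- t) = f t) /\
    (forall a b, 0 <= a -> a <= b -> b <= 2^-1 -> (f b <= f a)%E) /\
    F = [set x | -(2^-1) <= x.1 <= 2^-1 /\ ((eucl x.2)%:E <= f x.1)%E].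

End Defs.

(* Main.v *)
Require Import Defs.
From HB Require Import structures.
From mathcomp Require Import all_boot all_order all_algebra.
From mathcomp Require Import all_classical all_reals all_analysis.
From mathcomp Require Import measurable_realfun ring lra.
Import Order.TTheory GRing.Theory Num.Theory.
Local Open Scope classical_set_scope.
Local Open Scope ring_scope.

Set Implicit Arguments.
Unset Strict Implicit.
Unset Printing Implicit Defensive.

(** The direct method. Take a minimizing sequence of profiles [f k]. By monotony
   a Helly-type selection gives a subsequence whose bodies converge, at the level
   of indicator functions, off a null set: countably many slices where the
   [f k] oscillate, together with the graph of the limit profile. Fatou's lemma
   makes the perimeter lower semicontinuous and bounds the volume of the limit
   from above. Volume cannot escape to infinity: monotony and the volume
   constraint force the body to be thinner than some [l] beyond a radius [r],
   with [l] tending to 0 as [r] grows, so each point of the body beyond [r] sees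
   a box of side [l] outside the body at distance comparable to [l]; this box
   contributes at least a constant times [l ^ (- s)] to the perimeter density,
   hence the volume beyond [r] is at most a constant times
   [l ^ s] times the perimeter. *)

(** * Integration over R^n by iterated integrals *)

Lemma ereal_rat_between (R : realType) (a b : \bar R) : (a < b)%E ->
  exists q : rat, (a < (ratr q)%:E < b)%E.
Proof.
have dense (x y : R) : x < y -> exists q : rat, x < ratr q < y.
  by move=> /rat_in_itvoo[q]; rewrite in_itv/= => ?; exists q.
case: a b => [a| |] [b| |] //= ab.
- by have [q qab] := dense a b ab; exists q; rewrite !lte_fin.
- have [|q /andP[aq _]] := dense a (a + 1); first by rewrite ltrDl.
  by exists q; rewrite lte_fin aq ltry.
- have [|q /andP[_ qb]] := dense (b - 1) b; first by rewrite gtrBl.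
  by exists q; rewrite lte_fin qb ltNyr.
- by exists 0%R; rewrite ltry ltNyr.
Qed.

(** Reduces every lower bound on a lower limit to eventual bounds by smaller constants, so that
    indicators can be treated case by case. *)
Lemma le_limn_einfP (R : realType) (u : nat -> \bar R) (a : \bar R) :
  (forall c, (c < a)%E -> \forall k \near \oo, (c <= u k)%E) <->
  (a <= limn_einf u)%E.
Proof.
have E : limn_einf u =
    ereal_sup [set ereal_inf [set u x | x in V] | V in \oo].
  by rewrite -limf_einfE.
rewrite E; split => [ev|aL c ca].
  rewrite leNgt; apply/negP => /ereal_rat_between[q /andP[Lq qa]].
  have /ev := qa => qu.
  have : ((ratr q)%:E <= ereal_sup [set ereal_inf [set u x | x in V] | V in \oo])%E.
    apply: le_trans; last first.
      by apply: ereal_sup_ubound; exists [set k | ((ratr q)%:E <= u k)%E].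
    by apply: le_ereal_inf_tmp => _ [k /= qk <-].
  by rewrite leNgt Lq.
have [_ [V Voo <-] cV] := ereal_sup_gt (lt_le_trans ca aL).
apply: filterS Voo => k Vk.
by apply: (le_trans (ltW cV)); apply: ereal_inf_lbound; exists k.
Qed.

(** The integral of a nonnegative function is the supremum over the nonnegative simple functions
    below it, and that family grows with the function. This also covers indicators of arbitrary
    sets, as in [le_leb]. *)
Lemma le_ge0_integral (d : measure_display) (T : measurableType d)
    (R : realType) (mu : {measure set T -> \bar R}) (f g : T -> \bar R) :
  (forall x, 0 <= f x)%E -> (forall x, f x <= g x)%E ->
  (\int[mu]_x f x <= \int[mu]_x g x)%E.
Proof.
move=> f0 fg.
have g0 x : (0 <= g x)%E by exact: le_trans (fg x).
rewrite !ge0_integralTE//; apply: ereal_sup_le => _ [h /= hf <-].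
by exists h => //= x; exact: le_trans (fg x).
Qed.

(* ['rV[R]_m] has no canonical pointed structure, which measurable types need. *)
Definition rowvec (R : realType) (m : nat) : Type := 'rV[R]_m.

HB.instance Definition _ (R : realType) m := Choice.copy (rowvec R m) 'rV[R]_m.
HB.instance Definition _ (R : realType) m :=
  isPointed.Build (rowvec R m) (0 : 'rV[R]_m).

(** These cylinders generate the product sigma-algebra, so a map into R^m is measurable as soon as
    its coordinates are. *)
Definition coord_sets (R : realType) (m : nat) : set (set (rowvec R m)) :=
  [set A | exists i B, measurable B /\ A = (fun v : 'rV[R]_m => v 0 i) @^-1` B].

Notation mrV R m := (g_sigma_algebraType (@coord_sets R m)).

(** * Measurability, linearity and Fatou's lemma for partial iterated integrals *)

Section measurable_rV.
Variable R : realType.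
Local Notation mu := (@lebesgue_measure R).

Lemma measurable_coord m (i : 'I_m) :
  measurable_fun [set: mrV R m] (fun v : mrV R m => (v : 'rV[R]_m) 0 i).
Proof.
move=> _ B mB; rewrite setTI.
by apply: sub_sigma_algebra; exists i, B.
Qed.

Lemma measurable_fun_rV (d : measure_display) (T : measurableType d) m
    (h : T -> mrV R m) :
  (forall i, measurable_fun [set: T] (fun t => (h t : 'rV[R]_m) 0 i)) ->
  measurable_fun [set: T] h.
Proof.
move=> mh; apply: (@measurability _ _ T (mrV R m) setT h (@coord_sets R m)) => //.
move=> _ [_ [i [B [mB ->]]] <-].
exact: mh.
Qed.

Lemma measurable_setc (d : measure_display) (T : measurableType d) m k
    (h : T -> mrV R m) (t : T -> R) :
  measurable_fun [set: T] h -> measurable_fun [set: T] t ->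
  measurable_fun [set: T] (fun x => setc (h x : 'rV[R]_m) k (t x) : mrV R m).
Proof.
move=> mh mt; apply: measurable_fun_rV => i.
under eq_fun do rewrite mxE.
case: (_ == k) => //.
exact: (measurableT_comp (measurable_coord i) mh).
Qed.

Lemma iint_ge0 m k (f : 'rV[R]_m -> \bar R) v :
  (forall v, 0 <= f v)%E -> (0 <= iint k f v)%E.
Proof.
by elim: k v => [|k IH] v f0 //=; apply: integral_ge0 => t _; exact: IH.
Qed.

Lemma le_iint m k (f g : 'rV[R]_m -> \bar R) v :
  (forall v, 0 <= f v)%E -> (forall v, f v <= g v)%E ->
  (iint k f v <= iint k g v)%E.
Proof.
move=> f0 fg; elim: k v => [|k IH] v //=.
by apply: le_ge0_integral => t; [exact: iint_ge0|exact: IH].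
Qed.

(** Tonelli's theorem preserves joint measurability at each integration. The parameter space [T] is
    what later makes an integral that depends on a point measurable in that point. *)
Lemma measurable_iint_param (d : measure_display) (T : measurableType d) m k
    (G : T -> 'rV[R]_m -> \bar R) :
  measurable_fun setT (fun p : T * mrV R m => G p.1 p.2) ->
  (forall t v, 0 <= G t v)%E ->
  measurable_fun setT (fun p : T * mrV R m => iint k (G p.1) p.2).
Proof.
move=> mG G0; elim: k => [//|k IH] /=.
pose H (z : (T * mrV R m) * R) := iint k (G z.1.1) (setc z.1.2 k z.2).
have mH : measurable_fun [set: (T * mrV R m) * R] H.
  apply: (measurableT_comp IH
    (g := fun z : (T * mrV R m) * R => (z.1.1, setc z.1.2 k z.2 : mrV R m))).
  apply: measurable_fun_pair.
    exact: (measurableT_comp measurable_fst measurable_fst).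
  apply: measurable_setc; last exact: measurable_snd.
  exact: (measurableT_comp measurable_snd measurable_fst).
apply: (@measurable_fun_fubini_tonelli_F _ _ _ _ R mu H mH).
by move=> z; exact: iint_ge0.
Qed.

Lemma measurable_iint m k (f : 'rV[R]_m -> \bar R) :
  measurable_fun [set: mrV R m] f -> (forall v, 0 <= f v)%E ->
  measurable_fun [set: mrV R m] (iint k f).
Proof.
move=> mf f0.
have mG : measurable_fun setT (fun p : unit * mrV R m => f p.2).
  exact: (measurableT_comp mf measurable_snd).
have := measurable_iint_param k (G := fun _ : unit => f) mG (fun _ => f0).
move=> /measurableT_comp/(_ (measurable_pair1 tt)).
by apply.
Qed.

Lemma measurable_iint_setc m k (f : 'rV[R]_m -> \bar R) v :
  measurable_fun [set: mrV R m] f -> (forall v, 0 <= f v)%E ->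
  measurable_fun [set: R] (fun t => iint k f (setc v k t)).
Proof.
move=> mf f0; apply: (measurableT_comp (measurable_iint k mf f0)).
by apply: measurable_setc => //; exact: measurable_cst.
Qed.

Lemma iintD m k (f g : 'rV[R]_m -> \bar R) v :
  measurable_fun [set: mrV R m] f -> measurable_fun [set: mrV R m] g ->
  (forall v, 0 <= f v)%E -> (forall v, 0 <= g v)%E ->
  iint k (fun v => f v + g v)%E v = (iint k f v + iint k g v)%E.
Proof.
move=> mf mg f0 g0; elim: k v => [//|k IH] v /=.
under eq_integral do rewrite IH.
by rewrite ge0_integralD//; first [by move=> *; exact: iint_ge0
  | exact: measurable_iint_setc].
Qed.

Lemma iintZ m k (c : \bar R) (f : 'rV[R]_m -> \bar R) v :
  measurable_fun [set: mrV R m] f -> (forall v, 0 <= f v)%E -> (0 <= c)%E ->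
  iint k (fun v => c * f v)%E v = (c * iint k f v)%E.
Proof.
move=> mf f0 c0; elim: k v => [//|k IH] v /=.
under eq_integral do rewrite IH.
rewrite ge0_integralZl//; first exact: measurable_iint_setc.
by move=> *; exact: iint_ge0.
Qed.

(** The one-dimensional Fatou lemma is applied once per coordinate, with the induction hypothesis
    inside the outer integral. *)
Lemma fatou_iint m k (f : nat -> 'rV[R]_m -> \bar R) v :
  (forall j, measurable_fun [set: mrV R m] (f j)) ->
  (forall j v, 0 <= f j v)%E ->
  (iint k (fun v => limn_einf (fun j => f j v)) v <=
   limn_einf (fun j => iint k (f j) v))%E.
Proof.
move=> mf f0; elim: k v => [//|k IH] v /=.
apply: le_trans (fatou mu measurableT
  (f := fun j t => iint k (f j) (setc v k t)) _ _); last 2 first.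
- by move=> j; exact: measurable_iint_setc.
- by move=> j t _; exact: iint_ge0.
apply: le_ge0_integral => t //=.
apply: iint_ge0 => w; apply/le_limn_einfP => c c0; apply: nearW => j.
exact: le_trans (ltW c0) _.
Qed.

End measurable_rV.

Notation mpt R n := (R * mrV R n.-1)%type.

(** * The same properties for the full integral, and volume *)

Section integral_Rn.
Variables (R : realType) (n : nat).
Local Notation mu := (@lebesgue_measure R).
Implicit Types f g : pt R n -> \bar R.

Lemma int_Rn_ge0 f : (forall x, 0 <= f x)%E -> (0 <= int_Rn f)%E.
Proof. by move=> f0; apply: integral_ge0 => t _; exact: iint_ge0. Qed.

Lemma le_int_Rn f g : (forall x, 0 <= f x)%E -> (forall x, f x <= g x)%E ->
  (int_Rn f <= int_Rn g)%E.
Proof.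
move=> f0 fg; apply: le_ge0_integral => t; first exact: iint_ge0.
by apply: le_iint.
Qed.

Lemma eq_int_Rn f g : f =1 g -> int_Rn f = int_Rn g.
Proof. by move=> /funext ->. Qed.

Lemma measurable_slice f t : measurable_fun [set: mpt R n] f ->
  measurable_fun [set: mrV R n.-1] (fun v => f (t, v)).
Proof. by move=> mf; exact: (measurableT_comp mf (measurable_pair1 t)). Qed.

Lemma measurable_int_Rn_param (d : measure_display) (T : measurableType d)
    (G : T -> pt R n -> \bar R) :
  measurable_fun setT (fun p : T * mpt R n => G p.1 p.2) ->
  (forall t x, 0 <= G t x)%E ->
  measurable_fun [set: T] (fun t => int_Rn (G t)).
Proof.
move=> mG G0.
pose H (z : T * R) := int_rV (fun v => G z.1 (z.2, v)).
have mH : measurable_fun [set: T * R] H.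
  have mI : measurable_fun setT (fun p : (T * R) * mrV R n.-1 =>
      G p.1.1 (p.1.2, p.2)).
    apply: (measurableT_comp mG
      (g := fun p : (T * R) * mrV R n.-1 => (p.1.1, (p.1.2, p.2)))).
    apply: measurable_fun_pair.
      exact: (measurableT_comp measurable_fst measurable_fst).
    apply: measurable_fun_pair; last exact: measurable_snd.
    exact: (measurableT_comp measurable_snd measurable_fst).
  have := measurable_iint_param n.-1
    (G := fun (z : T * R) v => G z.1 (z.2, v)) mI (fun _ _ => G0 _ _).
  move=> /measurableT_comp/(_ (measurable_pair2 (0 : mrV R n.-1))).
  by apply.
apply: (@measurable_fun_fubini_tonelli_F _ _ _ _ R mu H mH).
by move=> z; exact: iint_ge0.
Qed.

Lemma measurable_int_slice f : measurable_fun [set: mpt R n] f ->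
  (forall x, 0 <= f x)%E ->
  measurable_fun [set: R] (fun t => int_rV (fun v => f (t, v))).
Proof.
move=> mf f0.
have mf' : measurable_fun [set: mpt R n] (fun p => f (p.1, p.2)).
  by rewrite [X in measurable_fun _ X](_ : _ = f)//; apply/funext => -[].
have := measurable_iint_param n.-1
  (G := fun (t : R) (v : 'rV[R]_n.-1) => f (t, v)).
move=> /(_ mf' (fun _ _ => f0 _)).
move=> /measurableT_comp/(_ (measurable_pair2 (0 : mrV R n.-1))).
by apply.
Qed.

Lemma int_RnD f g :
  measurable_fun [set: mpt R n] f -> measurable_fun [set: mpt R n] g ->
  (forall x, 0 <= f x)%E -> (forall x, 0 <= g x)%E ->
  int_Rn (fun x => f x + g x)%E = (int_Rn f + int_Rn g)%E.
Proof.
move=> mf mg f0 g0; rewrite /int_Rn /int_rV.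
under eq_integral => t _.
  rewrite (iintD _ _ (measurable_slice t mf) (measurable_slice t mg))//.
  over.
by rewrite ge0_integralD//; first [by move=> *; exact: iint_ge0
  | exact: measurable_int_slice].
Qed.

Lemma int_RnZ (c : \bar R) f : measurable_fun [set: mpt R n] f ->
  (forall x, 0 <= f x)%E -> (0 <= c)%E ->
  int_Rn (fun x => c * f x)%E = (c * int_Rn f)%E.
Proof.
move=> mf f0 c0; rewrite /int_Rn /int_rV.
under eq_integral => t _.
  rewrite (iintZ _ _ (measurable_slice t mf))//.
  over.
rewrite ge0_integralZl//; first exact: measurable_int_slice.
by move=> *; exact: iint_ge0.
Qed.

Lemma fatou_int_Rn (f : nat -> pt R n -> \bar R) :
  (forall j, measurable_fun [set: mpt R n] (f j)) ->
  (forall j x, 0 <= f j x)%E ->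
  (int_Rn (fun x => limn_einf (fun j => f j x)) <=
   limn_einf (fun j => int_Rn (f j)))%E.
Proof.
move=> mf f0.
apply: le_trans (fatou mu measurableT
  (f := fun j t => int_rV (fun v => f j (t, v))) _ _); last 2 first.
- by move=> j; exact: measurable_int_slice.
- by move=> j t _; exact: iint_ge0.
apply: le_ge0_integral => t /=.
  apply: iint_ge0 => w; apply/le_limn_einfP => c c0; apply: nearW => j.
  exact: le_trans (ltW c0) _.
apply: (fatou_iint _ (f := fun j v => f j (t, v))) => // j.
exact: measurable_slice.
Qed.

Lemma measurable_indicE (A : set (pt R n)) : measurable (A : set (mpt R n)) ->
  measurable_fun [set: mpt R n] (fun x => (\1_A x)%:E : \bar R).
Proof. by move=> mA; apply/measurable_EFinP; exact: measurable_indic. Qed.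

Lemma indicE_ge0 (A : set (pt R n)) x : (0 <= (\1_A x)%:E :> \bar R)%E.
Proof. by rewrite lee_fin. Qed.

(* The values of the [f j] on the null set [N] are raised to [+oo], which does
   not change their integrals. *)
Lemma fatou_int_Rn_null (N : set (pt R n)) g (f : nat -> pt R n -> \bar R) :
  measurable (N : set (mpt R n)) -> leb N = 0%E ->
  (forall j, measurable_fun [set: mpt R n] (f j)) ->
  (forall j x, 0 <= f j x)%E -> (forall x, 0 <= g x)%E ->
  (forall x, ~ N x -> g x <= limn_einf (fun j => f j x))%E ->
  (int_Rn g <= limn_einf (fun j => int_Rn (f j)))%E.
Proof.
move=> mN N0 mf f0 g0 gf.
pose f' j x := (f j x + +oo * (\1_N x)%:E)%E.
have mI := measurable_indicE mN.
have moo : measurable_fun [set: mpt R n] (fun x => +oo * (\1_N x)%:E : \bar R)%E.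
  exact: measurable_funeM.
have oo0 x : (0 <= +oo * (\1_N x)%:E :> \bar R)%E by rewrite mule_ge0// indicE_ge0.
have E j : int_Rn (f' j) = int_Rn (f j).
  rewrite int_RnD// int_RnZ//.
  by rewrite -/(leb N) N0 mule0 adde0.
under [X in limn_einf X]funext => j do rewrite -E.
apply: le_trans (fatou_int_Rn _ _); last 2 first.
- by move=> j; exact: emeasurable_funD.
- by move=> j x; exact: adde_ge0.
apply: le_int_Rn => // x; apply/le_limn_einfP => c cg.
have [xN|xN] := pselect (N x).
  apply: nearW => j; rewrite /f' indicE mem_set// mule1 addey ?leey//.
  by rewrite gt_eqF// (lt_le_trans _ (f0 j x))// ltNyr.
have /le_limn_einfP/(_ _ cg) := gf x xN.
apply: filterS => j cf.
by rewrite /f' indicE memNset// mule0 adde0.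
Qed.

Lemma le_leb (A B : set (pt R n)) : A `<=` B -> (leb A <= leb B)%E.
Proof.
move=> AB; apply: le_int_Rn => x; first exact: indicE_ge0.
rewrite lee_fin !indicE; have [/set_mem/AB/mem_set->//|_] := boolP (x \in A).
by rewrite ler0n.
Qed.

Lemma lebU (A B : set (pt R n)) : measurable (A : set (mpt R n)) ->
  measurable (B : set (mpt R n)) -> A `&` B = set0 ->
  leb (A `|` B) = (leb A + leb B)%E.
Proof.
move=> mA mB AB; rewrite /leb -int_RnD; first last.
- by move=> x; exact: indicE_ge0.
- by move=> x; exact: indicE_ge0.
- exact: measurable_indicE.
- exact: measurable_indicE.
apply: eq_int_Rn => x; rewrite -EFinD; congr EFin; rewrite !indicE in_setU.
have [xA|xA] := boolP (x \in A); have [xB|xB] := boolP (x \in B);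
  rewrite ?addr0 ?add0r//.
have : (A `&` B) x by split; exact: set_mem.
by rewrite AB.
Qed.

End integral_Rn.

(** * Cubes, boxes and spheres *)

Section cubes.
Variable R : realType.
Local Notation mu := (@lebesgue_measure R).

Definition cube m (a : 'rV[R]_m) (l : R) : set 'rV[R]_m :=
  [set v | forall i, a 0 i <= v 0 i <= a 0 i + l].

Lemma integralZ_indic (c : \bar R) (A : set R) : (0 <= c)%E -> measurable A ->
  (\int[mu]_t (c * (\1_A t)%:E) = c * mu A)%E.
Proof.
move=> c0 mA; rewrite ge0_integralZl ?integral_indic ?setIT//.
by apply/measurable_EFinP; exact: measurable_indic.
Qed.

(** Each integration contributes a factor [l] and removes one constraint; keeping the constraints on
    the remaining coordinates makes the induction work. *)
Lemma iint_cube m k (a : 'rV[R]_m) l v : 0 <= l -> (k <= m)%N ->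
  iint k (fun w => (\1_(cube a l) w)%:E) v =
  (l ^+ k * \1_[set w : 'rV[R]_m |
     forall i : 'I_m, (k <= i)%N -> a 0 i <= w 0 i <= a 0 i + l] v)%:E.
Proof.
move=> l0; elim: k v => [|k IH] v km /=.
  rewrite expr0 mul1r; congr ((\1_ _ v)%:E); apply/seteqP; split => w /= wa i //.
  exact: wa.
pose i0 := Ordinal km.
pose I := `[a 0 i0, a 0 i0 + l]%classic : set R.
set C := [set w : 'rV[R]_m | forall i : 'I_m, (k < i)%N ->
  a 0 i <= w 0 i <= a 0 i + l].
have E t : iint k (fun w => (\1_(cube a l) w)%:E) (setc v k t) =
    ((l ^+ k * \1_C v)%:E * (\1_I t)%:E)%E.
  rewrite IH; last exact: ltnW.
  rewrite -EFinM -mulrA; congr (_ * _)%:E.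
  rewrite -[RHS]/((\1_C v * \1_I t) : R) !indicE.
  rewrite -natrM mulnb; congr (_%:R); congr nat_of_bool.
  apply/idP/idP => [/set_mem /= H|/andP[/set_mem /= vC /set_mem tI]].
    apply/andP; split; apply/mem_set.
      move=> i ki; have := H i (ltnW ki); rewrite mxE.
      by rewrite gtn_eqF.
    by have := H i0 (leqnn k); rewrite mxE eqxx /I /= in_itv.
  apply/mem_set => /= i ki; rewrite mxE.
  have [ik|ik] := eqVneq (i : nat) k; last first.
    by apply: vC; rewrite ltn_neqAle eq_sym ik.
  have -> : i = i0 by exact: val_inj.
  by move: tI; rewrite /I /= in_itv.
under eq_integral do rewrite E.
have mI : measurable I by exact: measurable_itv.
rewrite integralZ_indic ?lee_fin ?mulr_ge0 ?exprn_ge0// /I lebesgue_measure_itv/= lte_fin.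
(* The length formula separates degenerate intervals; the second case forces [l = 0], where both
   sides vanish. *)
have [_|] := ltP (a 0 i0) (a 0 i0 + l).
  by rewrite -EFinB -EFinM; congr EFin; rewrite exprS; ring.
rewrite gerDl => l0'; have -> : l = 0 by apply/eqP; rewrite eq_le l0 l0'.
by rewrite mule0 exprS !mul0r.
Qed.

Lemma int_rV_cube m (a : 'rV[R]_m) l : 0 <= l ->
  int_rV (fun w => (\1_(cube a l) w)%:E) = (l ^+ m)%:E.
Proof.
move=> l0; rewrite /int_rV iint_cube// indicE mem_set ?mulr1// => i /=.
by rewrite leqNgt ltn_ord.
Qed.

Definition box n (a b : R) (c : 'rV[R]_n.-1) (l : R) : set (pt R n) :=
  [set x | a <= x.1 <= b /\ cube c l x.2].

Lemma leb_box n a b (c : 'rV[R]_n.-1) l : a <= b -> 0 <= l ->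
  leb (box a b c l) = ((b - a) * l ^+ n.-1)%:E.
Proof.
move=> ab l0; rewrite /leb /int_Rn.
pose I := `[a, b]%classic : set R.
have E t : int_rV (fun v => (\1_(box a b c l) (t, v))%:E) =
    ((l ^+ n.-1)%:E * (\1_I t)%:E)%E.
  have [tI|tI] := pselect (I t).
    rewrite indicE mem_set// mule1 -(int_rV_cube c l0); congr int_rV.
    apply/funext => v; congr (_%:R%:E); congr nat_of_bool.
    apply/idP/idP => /set_mem; last first.
      by move=> vc; apply/mem_set; split => //; move: tI; rewrite /I /= in_itv.
    by move=> [_ vc]; exact/mem_set.
  rewrite [\1_I t]indicE memNset// mule0.
  (* Zero is written as a product so that [iintZ] evaluates its integral. *)
  have -> : (fun v => (\1_(box a b c l) (t, v))%:E) =
      (fun v : 'rV[R]_n.-1 => (0 : \bar R)%E * 0)%E.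
    apply/funext => v; rewrite mule0 indicE memNset// => -[tab _]; apply: tI.
    by rewrite /I /= in_itv.
  by rewrite /int_rV iintZ// mul0e.
under eq_integral do rewrite E.
have mI : measurable I by exact: measurable_itv.
rewrite integralZ_indic ?lee_fin ?exprn_ge0// /I lebesgue_measure_itv/= lte_fin.
have [_|ba] := ltP a b.
  by rewrite -EFinB -EFinM mulrC.
have -> : a = b by apply/eqP; rewrite eq_le ab ba.
by rewrite mule0 subrr mul0r.
Qed.

Lemma measurable_cube m (a : 'rV[R]_m) l :
  measurable (cube a l : set (mrV R m)).
Proof.
have -> : cube a l = \bigcap_(i in [set: 'I_m])
    ((fun v : mrV R m => (v : 'rV[R]_m) 0 i) @^-1` `[a 0 i, a 0 i + l]%classic).
  apply/seteqP; split => v /= va i; first by move=> _; rewrite /= in_itv; exact: va.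
  by have := va i I; rewrite /= in_itv.
apply: fin_bigcap_measurable => // i _.
rewrite -[X in measurable X]setTI.
by apply: measurable_coord => //; exact: measurable_itv.
Qed.

Lemma measurable_box n a b (c : 'rV[R]_n.-1) l :
  measurable (box a b c l : set (mpt R n)).
Proof.
have -> : box a b c l = `[a, b]%classic `*` cube c l.
  by apply/seteqP; split => x /=; rewrite in_itv.
by apply: measurableX; [exact: measurable_itv|exact: measurable_cube].
Qed.

Lemma eucl_ge0 m (v : 'rV[R]_m) : 0 <= eucl v.
Proof. exact: sqrtr_ge0. Qed.

Lemma sqr_eucl m (v : 'rV[R]_m) : eucl v ^+ 2 = \sum_i v 0 i ^+ 2.
Proof. by rewrite sqr_sqrtr// sumr_ge0// => i _; exact: sqr_ge0. Qed.

(* The innermost integration variable, coordinate 0, is determined up to sign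
   by the others. *)
Lemma int_rV_sphere m (c : \bar R) : (0 < m)%N ->
  int_rV (fun v : 'rV[R]_m => (\1_[set w | (eucl w)%:E = c] v)%:E) = 0%E.
Proof.
case: m => // m _; rewrite /int_rV; set f := fun v => _.
have f0 v : (0 <= f v)%E by rewrite lee_fin.
suff H k v : iint k.+1 f v = 0%E by exact: H.
elim: k v => [|k IH] v; last first.
  rewrite -[LHS]/(\int[mu]_t iint k.+1 f (setc v k.+1 t))%E.
  by under eq_integral do rewrite IH; rewrite integral0.
rewrite /=; apply/eqP; rewrite eq_le integral_ge0 ?andbT; last by [].
have [[t0 Ht0]|H] := pselect (exists t, (eucl (setc v 0 t))%:E = c); last first.
  rewrite integral0_eq// => t _.
  by rewrite /f indicE memNset//= => ?; apply: H; exists t.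
pose A := \sum_(i < m.+1 | i != ord0) v 0 i ^+ 2.
have sqE t : eucl (setc v 0 t) ^+ 2 = t ^+ 2 + A.
  rewrite sqr_eucl (bigD1 (@ord0 m))//= !mxE eqxx; congr (_ + _).
  by apply: eq_bigr => i i0; rewrite !mxE ifN.
have sph t : (eucl (setc v 0 t))%:E = c -> t = t0 \/ t = - t0.
  rewrite -Ht0 => -[] /(congr1 (fun x => x ^+ 2)).
  rewrite !sqE => /addIr/eqP.
  by rewrite eqf_sqr => /orP[]/eqP; [left|right].
have cS : countable ([set t0; - t0] : set R) by exact: finite_set_countable.
have mS : measurable ([set t0; - t0] : set R).
  by apply: measurableU; exact: measurable_set1.
apply: (@le_trans _ _ (\int[mu]_t (\1_[set t0; - t0] t)%:E)%E).
  apply: le_ge0_integral => // t; rewrite lee_fin /f !indicE.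
  have [/set_mem/= /sph tt0|_] := boolP (_ \in _); last by rewrite ler0n.
  by rewrite mem_set.
rewrite integral_indic// setIT.
by have := countable_lebesgue_measure0 cS => /= ->.
Qed.

(** The slices over [D] are bounded by [+oo] on a null set of first coordinates; any other slice
    lies in a sphere of R^(n-1), which is null because [n >= 2]. *)
Lemma leb_graph_null n (D : set R) (g : R -> \bar R) : (2 <= n)%N ->
  countable D -> leb [set x : pt R n | D x.1 \/ (eucl x.2)%:E = g x.1] = 0%E.
Proof.
move=> n2 cD; rewrite /leb /int_Rn; set N := [set x | _].
apply/eqP; rewrite eq_le integral_ge0 ?andbT; last first.
  by move=> t _; apply: iint_ge0 => v; rewrite lee_fin.
have mD : measurable D by exact: countable_measurable.
apply: (@le_trans _ _ (\int[mu]_t (+oo * (\1_D t)%:E))%E).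
  apply: le_ge0_integral => t.
    by apply: iint_ge0 => v; rewrite lee_fin.
  have [tD|tD] := pselect (D t).
    by rewrite [\1_D t]indicE mem_set// mule1 leey.
  rewrite [\1_D t]indicE memNset// mule0.
  rewrite -[leRHS](@int_rV_sphere n.-1 (g t)); last by case: n n2 {N} => [|[]].
  apply: le_iint => v; first by rewrite lee_fin.
  rewrite lee_fin !indicE.
  have [/set_mem[//|/= vg]|_] := boolP (_ \in N); last by rewrite ler0n.
  by rewrite mem_set.
by rewrite integralZ_indic// countable_lebesgue_measure0// mule0.
Qed.

End cubes.

(** * The kernel and the bodies of the class K *)

Section kernel.
Variable R : realType.

Lemma measurable_eucl (d : measure_display) (T : measurableType d) m
    (h : T -> mrV R m) : measurable_fun [set: T] h ->
  measurable_fun [set: T] (fun x => eucl (h x : 'rV[R]_m)).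
Proof.
move=> mh; apply: (measurableT_comp (continuous_measurable_fun (@sqrt_continuous R))).
apply: measurable_sum => i; apply: measurable_funX.
exact: (measurableT_comp (measurable_coord i) mh).
Qed.

Lemma measurable_normpt n (d : measure_display) (T : measurableType d)
    (h : T -> mpt R n) : measurable_fun [set: T] h ->
  measurable_fun [set: T] (fun x => normpt (h x : pt R n)).
Proof.
move=> mh; apply: (measurableT_comp (continuous_measurable_fun (@sqrt_continuous R))).
apply: measurable_funD; apply: measurable_funX.
  exact: (measurableT_comp measurable_fst mh).
apply: measurable_eucl.
exact: (measurableT_comp measurable_snd mh).
Qed.

(** This enumeration turns the sum over the integers in [Kern] into a series, whose measurability
    follows from that of its terms. *)
Definition int_of_nat (j : nat) : int := if odd j then Negz j./2 else Posz j./2.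

Lemma int_of_nat_bij : set_bij [set: nat] [set: int] int_of_nat.
Proof.
split => // [i j _ _|[j|j] _].
- rewrite /int_of_nat => eij.
  rewrite -(odd_double_half i) -(odd_double_half j).
  by move: eij; case: (odd i); case: (odd j) => // -[->].
- by exists j.*2 => //; rewrite /int_of_nat odd_double doubleK.
- exists j.*2.+1 => //; rewrite /int_of_nat /= odd_double /=.
  by rewrite uphalf_double.
Qed.

Definition Kterm n (s : R) (k : int) (x : pt R n) : \bar R :=
  let r := normpt ((x.1 + k%:~R, x.2) : pt R n) in
  if r == 0 then +oo%E else (r `^ (- (n%:R + s)))%:E.

Lemma Kterm_ge0 n s k (x : pt R n) : (0 <= Kterm s k x)%E.
Proof. by rewrite /Kterm; case: ifP => // _; rewrite lee_fin powR_ge0. Qed.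

Lemma measurable_Kterm n s k : measurable_fun [set: mpt R n] (@Kterm n s k).
Proof.
have mr : measurable_fun [set: mpt R n]
    (fun x => normpt ((x.1 + k%:~R, x.2) : pt R n)).
  apply: (@measurable_normpt n _ _
    (fun x : mpt R n => (x.1 + k%:~R, x.2) : mpt R n)).
  apply: measurable_fun_pair; last exact: measurable_snd.
  by apply: measurable_funD => //; exact: measurable_fst.
apply: measurable_fun_ifT.
- by apply: measurable_fun_eqr => //; exact: measurable_cst.
- exact: measurable_cst.
- by apply/measurable_EFinP; exact: (measurableT_comp (measurable_powR _) mr).
Qed.

Lemma Kern_ge0 n s (x : pt R n) : (0 <= Kern s x)%E.
Proof. by apply: esum_ge0 => k _; exact: Kterm_ge0. Qed.

Lemma measurable_Kern n s : measurable_fun [set: mpt R n] (@Kern R n s).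
Proof.
have -> : @Kern R n s = (fun x => \sum_(j <oo | j \in predT) Kterm s (int_of_nat j) x)%E.
  apply/funext => x; rewrite /Kern (reindex_esum _ _ _ _ int_of_nat_bij).
  by rewrite -nneseries_esumT// => j; exact: Kterm_ge0.
apply: ge0_emeasurable_sum => [j x _ _|j _]; first exact: Kterm_ge0.
exact: measurable_Kterm.
Qed.

(** The sum is a supremum over finite index sets, one of which is the singleton of 0. This term
    alone supplies the lower bounds on the perimeter. *)
Lemma Kterm0_le_Kern n s (x : pt R n) : (Kterm s 0 x <= Kern s x)%E.
Proof.
apply: esum_ge; exists [set 0]; first by split => //; exact: finite_set1.
by rewrite fsbig_set1.
Qed.

Lemma measurable_Kern_ptsub n s : measurable_fun setT
  (fun p : mpt R n * mpt R n => Kern s (ptsub p.2 p.1 : pt R n)).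
Proof.
apply: (measurableT_comp (@measurable_Kern n s)
  (g := fun p : mpt R n * mpt R n => ptsub p.2 p.1 : mpt R n)).
have m1 : measurable_fun setT (fun p : mpt R n * mpt R n => p.1.1).
  exact: (measurableT_comp measurable_fst measurable_fst).
have m2 : measurable_fun setT (fun p : mpt R n * mpt R n => p.2.1).
  exact: (measurableT_comp measurable_fst measurable_snd).
have m3 : measurable_fun setT (fun p : mpt R n * mpt R n => p.1.2).
  exact: (measurableT_comp measurable_snd measurable_fst).
have m4 : measurable_fun setT (fun p : mpt R n * mpt R n => p.2.2).
  exact: (measurableT_comp measurable_snd measurable_snd).
apply: measurable_fun_pair; first exact: measurable_funB.
apply: measurable_fun_rV => i; under eq_fun do rewrite !mxE.
by apply: measurable_funB; exact: (measurableT_comp (measurable_coord i)).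
Qed.

End kernel.

(** * Profiles, measurability of their bodies, and the perimeter density *)

Section profiles.
Variable R : realType.

Definition profile (f : R -> \bar R) : Prop :=
  (forall t, -(2^-1) <= t <= 2^-1 -> (0 <= f t)%E) /\
  (forall t, -(2^-1) <= t <= 2^-1 -> f (- t) = f t) /\
  (forall a b, 0 <= a -> a <= b -> b <= 2^-1 -> (f b <= f a)%E).

Definition body n (f : R -> \bar R) : set (pt R n) :=
  [set x | -(2^-1) <= x.1 <= 2^-1 /\ ((eucl x.2)%:E <= f x.1)%E].

Lemma inKP n (F : set (pt R n)) : inK F <-> exists2 f, profile f & F = body f.
Proof.
split=> [[f [f0 [fN [fd FE]]]]|[f [f0 [fN fd]] ->]]; first by exists f.
by exists f.
Qed.

(* Extending by [-oo] makes every superlevel set an interval. *)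
Definition strip_ext (f : R -> \bar R) (t : R) : \bar R :=
  if -(2^-1) <= t <= 2^-1 then f t else -oo%E.

Lemma bodyE n f : @body n f = [set x | ((eucl x.2)%:E <= strip_ext f x.1)%E].
Proof.
apply/seteqP; split => x /=; rewrite /strip_ext.
  by move=> [-> ].
by case: ifP => //; rewrite leeNy_eq.
Qed.

Lemma profile_abs f t : profile f -> -(2^-1) <= t <= 2^-1 -> f `|t| = f t.
Proof.
move=> [_ [fN _]] tS; have [t0|t0] := leP 0 t; first by rewrite ger0_norm.
by rewrite ltr0_norm// fN.
Qed.

Lemma profile_le f a b : profile f -> -(2^-1) <= b <= 2^-1 -> `|a| <= `|b| ->
  (f b <= f a)%E.
Proof.
move=> pf bS ab; have b2 : `|b| <= 2^-1 by rewrite ler_norml.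
have aS : -(2^-1) <= a <= 2^-1 by rewrite -ler_norml (le_trans ab).
rewrite -(profile_abs pf bS) -(profile_abs pf aS).
by case: pf => _ [_]; apply.
Qed.

Lemma measurable_strip_ext f : profile f -> measurable_fun [set: R] (strip_ext f).
Proof.
move=> pf; apply: (@measurability _ _ _ _ _ _ (@ErealGenCInfty.G R)).
  exact: ErealGenCInfty.measurableE.
move=> _ [_ [r ->] <-]; rewrite setTI.
apply: is_interval_measurable => x y; rewrite /= !in_itv/= !andbT => fx fy z xyz.
rewrite in_itv/= andbT.
have nS t : (r%:E <= strip_ext f t)%E -> -(2^-1) <= t <= 2^-1.
  by rewrite /strip_ext; case: ifP => //; rewrite leeNy_eq.
have xS := nS _ fx; have yS := nS _ fy.
have zS : -(2^-1) <= z <= 2^-1 by lra.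
move: fx fy; rewrite /strip_ext xS yS zS => fx fy.
(* A point between [x] and [y] is no farther from 0 than one of them, and the profile is at least as
   large there as at that one. *)
have : (`|z| <= `|x|) || (`|z| <= `|y|).
  have [z0|z0] := leP 0 z.
    by apply/orP; right; rewrite !ger0_norm//; lra.
  by apply/orP; left; rewrite !ltr0_norm//; lra.
by move=> /orP[zx|zy]; [apply: le_trans fx _|apply: le_trans fy _];
  exact: profile_le.
Qed.

Lemma measurable_fun_euclE n :
  measurable_fun [set: mpt R n] (fun x => (eucl (x.2 : 'rV[R]_n.-1))%:E).
Proof.
by apply/measurable_EFinP; apply: measurable_eucl; exact: measurable_snd.
Qed.

Lemma measurable_body n f : profile f -> measurable (@body n f : set (mpt R n)).
Proof.
move=> pf; rewrite bodyE -[X in measurable X]setTI.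
apply: measurable_lee => //; first exact: measurable_fun_euclE.
exact: (measurableT_comp (measurable_strip_ext pf) measurable_fst).
Qed.

Lemma measurable_graph n D f : profile f -> countable D ->
  measurable ([set x | D x.1 \/ (eucl x.2)%:E = strip_ext f x.1] : set (mpt R n)).
Proof.
move=> pf cD.
have mg : measurable_fun [set: mpt R n] (fun x => strip_ext f x.1).
  exact: (measurableT_comp (measurable_strip_ext pf) measurable_fst).
have -> : [set x | D x.1 \/ (eucl x.2)%:E = strip_ext f x.1] =
    (D `*` [set: mrV R n.-1]) `|`
    (([set: mpt R n] `&` [set x | (eucl x.2)%:E <= strip_ext f x.1]%E) `&`
     ([set: mpt R n] `&` [set x | strip_ext f x.1 <= (eucl x.2)%:E]%E)).
  apply/seteqP; split => x /=.
    move=> [Dx|xf]; [by left|right].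
    by rewrite xf.
  move=> [[Dx _]|[[_ xf] [_ fx]]]; [by left|right].
  by apply/eqP; rewrite eq_le xf fx.
apply: measurableU.
  by apply: measurableX => //; exact: countable_measurable.
have me := @measurable_fun_euclE n.
by apply: measurableI; apply: measurable_lee.
Qed.

Lemma measurable_strip n : measurable (@strip R n : set (mpt R n)).
Proof.
have -> : @strip R n = `[-(2^-1), 2^-1]%classic `*` [set: mrV R n.-1].
  by apply/seteqP; split => x /=; rewrite in_itv// => -[].
by apply: measurableX => //; exact: measurable_itv.
Qed.

(** The perimeter density at [y], that is, the inner integral of [PS]. *)
Definition interaction n (s : R) (F : set (pt R n)) (y : pt R n) : \bar R :=
  int_Rn (fun x => (\1_(@strip R n `\` F) x)%:E * Kern s (ptsub x y))%E.

Lemma interaction_ge0 n s (F : set (pt R n)) y : (0 <= interaction s F y)%E.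
Proof.
by apply: int_Rn_ge0 => x; rewrite mule_ge0 ?indicE_ge0 ?Kern_ge0.
Qed.

Lemma measurable_stripD n (F : set (pt R n)) : measurable (F : set (mpt R n)) ->
  measurable (@strip R n `\` F : set (mpt R n)).
Proof. by move=> mF; apply: measurableD => //; exact: measurable_strip. Qed.

Lemma measurable_interaction_fun n s (F : set (pt R n)) y :
  measurable (F : set (mpt R n)) ->
  measurable_fun [set: mpt R n]
    (fun x => (\1_(@strip R n `\` F) x)%:E * Kern s (ptsub x y))%E.
Proof.
move=> mF; apply: emeasurable_funM.
  by apply: measurable_indicE; exact: measurable_stripD.
apply: (measurableT_comp (@measurable_Kern_ptsub R n s)
  (g := fun x : mpt R n => (y : mpt R n, x))).
by apply: measurable_fun_pair => //; exact: measurable_cst.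
Qed.

Lemma measurable_interaction n s (F : set (pt R n)) :
  measurable (F : set (mpt R n)) ->
  measurable_fun [set: mpt R n] (interaction s F).
Proof.
move=> mF; apply: (@measurable_int_Rn_param R n _ (mpt R n)
  (fun y x => (\1_(@strip R n `\` F) x)%:E * Kern s (ptsub x y))%E).
  apply: emeasurable_funM; last exact: measurable_Kern_ptsub.
  apply: (measurableT_comp (measurable_indicE (measurable_stripD mF))).
  exact: measurable_snd.
by move=> y x; rewrite mule_ge0 ?indicE_ge0 ?Kern_ge0.
Qed.

Lemma PSE n s (F : set (pt R n)) : PS s F =
  int_Rn (fun y => (\1_(F `&` @strip R n) y)%:E * interaction s F y)%E.
Proof. by []. Qed.

Lemma measurable_PS_fun n s (F : set (pt R n)) :
  measurable (F : set (mpt R n)) -> measurable_fun [set: mpt R n]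
    (fun y => (\1_(F `&` @strip R n) y)%:E * interaction s F y)%E.
Proof.
move=> mF; apply: emeasurable_funM; last exact: measurable_interaction.
by apply: measurable_indicE; apply: measurableI => //; exact: measurable_strip.
Qed.

End profiles.

(** * Tightness *)

Section geometry.
Variable R : realType.
Local Notation mu := (@lebesgue_measure R).

Lemma le_eucl_sqr m (v : 'rV[R]_m) (c : R) : 0 <= c ->
  \sum_i v 0 i ^+ 2 <= c ^+ 2 -> eucl v <= c.
Proof.
move=> c0 vc; rewrite -(@ler_pXn2r _ 2)// ?nnegrE ?eucl_ge0//.
by rewrite sqr_eucl.
Qed.

Lemma eucl_le_of_coord m (v : 'rV[R]_m) (c : R) : 0 <= c ->
  (forall i, `|v 0 i| <= c) -> eucl v <= m%:R * c.
Proof.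
move=> c0 vc; apply: le_eucl_sqr; first by rewrite mulr_ge0.
apply: (@le_trans _ _ (\sum_(i < m) c ^+ 2)).
  apply: ler_sum => i _.
  by rewrite -(real_normK (num_real (v 0 i))) lerXn2r ?nnegrE.
rewrite sumr_const card_ord -[leLHS]mulr_natl exprMn ler_wpM2r ?sqr_ge0//.
by rewrite -natrX ler_nat; case: m {v vc} => // m; rewrite leq_pmulr.
Qed.

Lemma coord_le_eucl m (v : 'rV[R]_m) i : `|v 0 i| <= eucl v.
Proof.
rewrite -(@ler_pXn2r _ 2)// ?nnegrE ?eucl_ge0// sqr_eucl (bigD1 i)//=.
by rewrite real_normK ?num_real// lerDl sumr_ge0// => j _; exact: sqr_ge0.
Qed.

Lemma le_eucl m (v w : 'rV[R]_m) : (forall i, `|v 0 i| <= `|w 0 i|) ->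
  eucl v <= eucl w.
Proof.
move=> vw; apply: le_eucl_sqr; first exact: eucl_ge0.
rewrite sqr_eucl; apply: ler_sum => i _.
by rewrite -(real_normK (num_real (v 0 i))) -(real_normK (num_real (w 0 i)))
  lerXn2r ?nnegrE.
Qed.

(** By monotony the profile is at least [f x.1] on the whole segment from 0 to [|x.1|], and a cube
    of side [r / (n-1)] with a corner at the origin lies in the ball of radius [r]. *)
Lemma cylinder_sub_body n (f : R -> \bar R) (x : pt R n) (r : R) :
  (2 <= n)%N -> profile f -> body f x -> 0 <= r <= eucl x.2 ->
  @box R n 0 `|x.1| 0 (r / n.-1%:R) `<=` body f.
Proof.
move=> n2 pf [xS xf] /andP[r0 rx] z [/= /andP[z0 zx] zc].
have m0 : (0 : R) < n.-1%:R by rewrite ltr0n; case: n n2 {x xS xf rx z z0 zx zc} => [|[]].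
have x2 : `|x.1| <= 2^-1 by rewrite ler_norml.
split; first by lra.
apply: (@le_trans _ _ (f x.1)); last first.
  by apply: profile_le => //; rewrite ger0_norm.
apply: le_trans xf; rewrite lee_fin; apply: le_trans rx.
have -> : r = n.-1%:R * (r / n.-1%:R) by rewrite mulrCA mulfV ?mulr1// gt_eqF.
apply: eucl_le_of_coord => [|i]; first by rewrite divr_ge0// ltW.
have /andP[] := zc i; rewrite mxE add0r => zi0 zi.
by rewrite ger0_norm.
Qed.

(** The box inscribed by [cylinder_sub_body] must fit into the volume [V], which makes the body thin
    at large radius. *)
Lemma body_width n (f : R -> \bar R) (V r : R) (x : pt R n) :
  (2 <= n)%N -> profile f -> leb (@body R n f) = V%:E -> body f x ->
  0 <= r <= eucl x.2 -> `|x.1| * (r / n.-1%:R) ^+ n.-1 <= V.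
Proof.
move=> n2 pf fV xf rx; rewrite -lee_fin -fV.
apply: le_trans (le_leb (cylinder_sub_body n2 pf xf rx)).
rewrite leb_box// ?subr0// divr_ge0//.
by case/andP: rx.
Qed.

Lemma normpt_le n (x : pt R n) (a b : R) : 0 <= a -> 0 <= b ->
  `|x.1| <= a -> eucl x.2 <= b -> normpt x <= a + b.
Proof.
move=> a0 b0 xa xb; rewrite -(@ler_pXn2r _ 2)// ?nnegrE ?sqrtr_ge0 ?addr_ge0//.
rewrite sqr_sqrtr ?addr_ge0 ?sqr_ge0//.
have xa2 : x.1 ^+ 2 <= a ^+ 2.
  by rewrite -(real_normK (num_real x.1)) lerXn2r ?nnegrE.
have xb2 : eucl x.2 ^+ 2 <= b ^+ 2 by rewrite lerXn2r ?nnegrE ?eucl_ge0.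
have ab : 0 <= a * b by exact: mulr_ge0.
by rewrite sqrrD; lra.
Qed.

Lemma Kern_ge_powR n (s : R) (x : pt R n) (c : R) : 0 < s -> normpt x <= c ->
  (((c `^ (- (n%:R + s)))%:E <= Kern s x)%E).
Proof.
move=> s0 xc; apply: le_trans (Kterm0_le_Kern s x).
rewrite /Kterm addr0; case: eqVneq => [_|x0]; first by rewrite leey.
have xpos : 0 < normpt (x.1, x.2) by rewrite lt_neqAle eq_sym x0 sqrtr_ge0.
have xc' : normpt (x.1, x.2) <= c by case: x xc {x0 xpos}.
have cpos := lt_le_trans xpos xc'.
rewrite lee_fin !powRN lef_pV2 ?posrE ?powR_gt0//.
have ns0 : 0 <= n%:R + s by rewrite addr_ge0// ltW.
by apply: ge0_ler_powR; rewrite // nnegrE ltW.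
Qed.

(* Beyond radius [r] the body is thinner than [l], so next to each of its
   points there is a box of side [l] outside the body. *)
Lemma interaction_lower_bound n (s : R) (f : R -> \bar R) (V r l : R) (y : pt R n) :
  (2 <= n)%N -> 0 < s -> profile f -> leb (@body R n f) = V%:E ->
  0 < r -> 0 < l <= 4^-1 -> V <= l * (r / n.-1%:R) ^+ n.-1 ->
  body f y -> r < eucl y.2 ->
  ((((n + 2)%:R * l) `^ (- (n%:R + s)) * l ^+ n)%:E <=
   interaction s (body f) y)%E.
Proof.
move=> n2 s0 pf fV r0 /andP[l0 l4] Vl yf ry.
have nE : n.-1.+1 = n by rewrite prednK// (leq_trans _ n2).
have m0 : (0 : R) < n.-1%:R by rewrite ltr0n -ltnS nE.
set K := (_ `^ _).
have K0 : 0 <= K by exact: powR_ge0.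
(* The cross-section of the box starts at [y.2] and extends away from the origin in each coordinate,
   so its points have at least the radius of [y]. *)
pose a : 'rV[R]_n.-1 := \row_i (if 0 <= y.2 0 i then y.2 0 i else y.2 0 i - l).
have y1 : `|y.1| <= l.
  rewrite -(@ler_pM2r _ ((r / n.-1%:R) ^+ n.-1)) ?exprn_gt0 ?divr_gt0//.
  by apply: le_trans Vl; apply: (body_width n2 pf fV yf); rewrite !ltW.
(* The first coordinate runs over [[l, 2l]]: past the half-width of the body, and still in the strip
   because [l <= 1/4]. *)
have inb (x : pt R n) : box l (l + l) a l x ->
    [/\ strip x, ~ body f x & normpt (ptsub x y) <= (n + 2)%:R * l].
  move=> [/= x1 xc].
  have yx : eucl y.2 <= eucl x.2.
    apply: le_eucl => i; have := xc i; rewrite mxE; case: ifPn => [yi|].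
      by move=> /andP[yxi _]; rewrite !ger0_norm// (le_trans yi).
    rewrite -ltNge subrK => yi /andP[_ xyi].
    by rewrite !ltr0_norm ?lerN2//; exact: le_lt_trans xyi _.
  split.
  - by rewrite /strip /=; lra.
  (* A point of the body in the box, having radius greater than [r], would violate the choice of [l]
     and [r] through [body_width]. *)
  - move=> xf; have : l * (eucl x.2 / n.-1%:R) ^+ n.-1 <= V.
      have := body_width (r := eucl x.2) n2 pf fV xf.
      rewrite eucl_ge0 lexx => /(_ isT); apply: le_trans.
      rewrite ler_wpM2r//; first by rewrite exprn_ge0// divr_ge0 ?eucl_ge0.
      by rewrite (le_trans _ (ler_norm _))//; case/andP: x1.
    move=> /le_trans/(_ Vl); rewrite ler_pM2l// leNgt => /negP; apply.
    have rx : r / n.-1%:R < eucl x.2 / n.-1%:R.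
      by rewrite ltr_pM2r ?invr_gt0// (lt_le_trans ry).
    have rm0 : 0 <= r / n.-1%:R by rewrite divr_ge0// ltW.
    rewrite ltrXn2r//.
    by rewrite -lt0n -ltnS nE.
  (* The first coordinates differ by at most [2l + l], and each of the other [n-1] coordinates by at
     most [l]. *)
  - have -> : (n + 2)%:R * l = 3 * l + n.-1%:R * l :> R.
      rewrite -mulrDl; congr (_ * _).
      rewrite -natrD; congr (_%:R).
      by rewrite -[in LHS]nE addSnnS addnC.
    apply: normpt_le; rewrite ?mulr_ge0 ?(ltW l0) ?(ltW m0)//=.
      by move: y1; rewrite !ler_norml => y1; lra.
    apply: eucl_le_of_coord => [|i]; first exact: ltW.
    have := xc i; rewrite !mxE ler_norml; case: ifPn => _ ?; lra.
have -> : (K * l ^+ n)%:E = int_Rn (fun x => K%:E * (\1_(box l (l + l) a l) x)%:E)%E.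
  rewrite int_RnZ//; last first.
    by apply: measurable_indicE; exact: measurable_box.
  by rewrite -/(leb _) leb_box ?lerDl ?ltW// -EFinM addrK -exprS nE.
apply: le_int_Rn => x; first by rewrite mule_ge0// lee_fin.
have [/set_mem xb|xb] := boolP (x \in box l (l + l) a l); last first.
  rewrite indicE (negbTE xb) mule0 mule_ge0 ?Kern_ge0//.
have [xS xf xy] := inb x xb.
rewrite !indicE !mem_set// mule1 mul1e.
exact: Kern_ge_powR.
Qed.

(** Integrates the bound of [interaction_lower_bound] over the part of the body beyond radius
    [r]. *)
Lemma tail_volume_le_PS n (s : R) (f : R -> \bar R) (V r l : R) :
  (2 <= n)%N -> 0 < s -> profile f -> leb (@body R n f) = V%:E ->
  0 < r -> 0 < l <= 4^-1 -> V <= l * (r / n.-1%:R) ^+ n.-1 ->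
  ((((n + 2)%:R * l) `^ (- (n%:R + s)) * l ^+ n)%:E *
    leb (@body R n f `&` [set x | (r < eucl x.2)%R]) <= PS s (@body R n f))%E.
Proof.
move=> n2 s0 pf fV r0 l0 Vl; set T := body f `&` _.
have mT : measurable (T : set (mpt R n)).
  apply: measurableI; first exact: measurable_body.
  rewrite -[X in measurable X]setTI.
  have := emeasurable_fun_o_infty measurableT (@measurable_fun_euclE R n) r%:E.
  by under eq_set do rewrite lte_fin.
have C0 : 0 <= ((n + 2)%:R * l) `^ (- (n%:R + s)) * l ^+ n.
  by rewrite mulr_ge0 ?powR_ge0 ?exprn_ge0//; case/andP: l0 => /ltW.
rewrite -int_RnZ//; last by apply: measurable_indicE.
rewrite PSE; apply: le_int_Rn => y; first by rewrite mule_ge0// lee_fin.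
have [/set_mem [yf ry]|yT] := boolP (y \in T); last first.
  by rewrite [\1_T y]indicE (negbTE yT) mule0 mule_ge0 ?interaction_ge0.
rewrite !indicE !mem_set//; last by split => //; case: yf.
by rewrite mule1 mul1e; exact: (interaction_lower_bound n2 s0 pf fV r0 l0 Vl).
Qed.

(** The powers of [l] combine to [l ^ (- s)], which is unbounded as [l] tends to 0. *)
Lemma box_scale_diverges n (s A : R) : 0 < s -> exists2 l, 0 < l <= 4^-1 &
  A <= ((n + 2)%:R * l) `^ (- (n%:R + s)) * l ^+ n.
Proof.
move=> s0.
have c0 : (0 : R) < (n + 2)%:R by rewrite ltr0n addn2.
pose k : R := (n + 2)%:R `^ (- (n%:R + s)).
have k0 : 0 < k by exact: powR_gt0.
pose B := Num.max 1 (A / k).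
have B1 : 1 <= B by rewrite le_max lexx.
(* [w] is the inverse of the scale: [w >= 4] gives [l <= 1/4], and [w >= B ^ (1/s)] gives
   [w ^ s >= B >= A / k]. *)
pose w := Num.max 4 (B `^ s^-1).
have w4 : 4 <= w by rewrite le_max lexx.
have w0 : 0 < w by lra.
exists w^-1; first by rewrite invr_gt0 w0 lef_pV2 ?posrE.
rewrite powRM ?invr_ge0 ?(ltW w0)// -/k -mulrA.
have -> : w^-1 `^ (- (n%:R + s)) * w^-1 ^+ n = w `^ s.
  rewrite -powR_inv1 ?(ltW w0)// -powR_mulrn ?powR_ge0//.
  rewrite -powRrM -[X in _ * X]powRrM -powRD; last first.
    by rewrite (gt_eqF w0) implybT.
  by congr powR; ring.
rewrite [leRHS]mulrC -ler_pdivrMr// (@le_trans _ _ B) ?le_max ?lexx ?orbT//.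
have -> : B = (B `^ s^-1) `^ s.
  by rewrite -powRrM mulVf ?powRr1 ?gt_eqF//; lra.
by apply: ge0_ler_powR; rewrite ?nnegrE ?powR_ge0 ?(ltW s0) ?(ltW w0)// le_max lexx orbT.
Qed.

(** The radius is uniform over all profiles of volume [V] and perimeter at most [A]: first [l] is
    chosen to make the constant at least [A / eps], then [r] large enough for the width
    condition. *)
Lemma tail_volume_small n (s V A eps : R) : (2 <= n)%N -> 0 < s -> 0 < V ->
  0 < eps -> exists2 r, 0 < r & forall f, profile f ->
    leb (@body R n f) = V%:E -> (PS s (@body R n f) <= A%:E)%E ->
    (leb (@body R n f `&` [set x | (r < eucl x.2)%R]) <= eps%:E)%E.
Proof.
move=> n2 s0 V0 eps0.
have m0 : (0 : R) < n.-1%:R by rewrite ltr0n; case: n n2 => [|[]].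
(* The maximum with 1 keeps the constant positive whatever the sign of [A]. *)
have [l l04] := box_scale_diverges n (Num.max 1 (A / eps)) s0.
set C := (X in _ <= X) => AC.
have /andP[l0 _] := l04.
have C0 : 0 < C by apply: lt_le_trans AC; rewrite lt_max ltr01.
(* Since [q >= 1] and [n-1 >= 1], the power [q ^ (n-1)] is at least [q], hence at least [V / l]. *)
pose q := 1 + V / l.
have q1 : 1 <= q by rewrite lerDl divr_ge0// ltW.
exists (n.-1%:R * q) => [|f pf fV fA].
  by rewrite mulr_gt0// (lt_le_trans _ q1).
have r0 : 0 < n.-1%:R * q by rewrite mulr_gt0// (lt_le_trans _ q1).
have Vl : V <= l * (n.-1%:R * q / n.-1%:R) ^+ n.-1.
  rewrite mulrAC mulfV ?mul1r ?gt_eqF// -ler_pdivrMl//.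
  apply: (@le_trans _ _ q); first by rewrite mulrC /q lerDr.
  by rewrite -[leLHS]expr1 ler_weXn2l//; case: n n2 {C AC C0 fV fA m0 r0} => [|[]].
have := le_trans (tail_volume_le_PS n2 s0 pf fV r0 l04 Vl) fA.
rewrite -/C => CA; rewrite leNgt; apply/negP => epsL.
have : (C%:E * eps%:E < A%:E)%E.
  by apply: lt_le_trans CA; rewrite lte_pmul2l// lte_fin.
rewrite -EFinM lte_fin ltNge => /negP; apply.
rewrite -ler_pdivrMr// (le_trans _ AC)// le_max lexx orbT//.
Qed.

(** The ball contains a cube of side [r / m] and lies in one of side [2r]. *)
Lemma int_rV_ball_fin m (r : R) : (0 < m)%N -> 0 <= r ->
  exists2 w, int_rV (fun v : 'rV[R]_m => (\1_[set v | eucl v <= r] v)%:E) = w%:E &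
    (r / m%:R) ^+ m <= w.
Proof.
move=> m0 r0; set J := int_rV _.
have m0' : (0 : R) < m%:R by rewrite ltr0n.
have lo : (((r / m%:R) ^+ m)%:E <= J)%E.
  rewrite -(int_rV_cube (0 : 'rV[R]_m)) ?divr_ge0//; apply: le_iint => v; first by rewrite lee_fin.
  rewrite lee_fin !indicE.
  have [/set_mem vc|_] := boolP (v \in cube _ _); last by rewrite ler0n.
  rewrite mem_set//=.
  have -> : r = m%:R * (r / m%:R) by rewrite mulrCA mulfV ?mulr1// gt_eqF.
  apply: eucl_le_of_coord => [|i]; first by rewrite divr_ge0.
  by have := vc i; rewrite mxE add0r => /andP[? ?]; rewrite ger0_norm.
have hi : (J <= ((r + r) ^+ m)%:E)%E.
  rewrite -(int_rV_cube (const_mx (- r))) ?addr_ge0//.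
  apply: le_iint => v; first by rewrite lee_fin.
  rewrite lee_fin !indicE.
  have [/set_mem /= vr|_] := boolP (v \in [set v | eucl v <= r]); last by rewrite ler0n.
  rewrite mem_set// => i /=; rewrite mxE addrA addNr add0r -ler_norml.
  exact: le_trans (coord_le_eucl v i) vr.
have Jfin : J \is a fin_num.
  rewrite ge0_fin_numE; first by rewrite (le_lt_trans hi)// ltry.
  by apply: le_trans lo; rewrite lee_fin exprn_ge0 ?divr_ge0.
by exists (fine J); rewrite ?fineK// -lee_fin fineK.
Qed.

(** A cylinder of suitable radius and length. It provides a competitor when the infimum of the
    perimeters is [+oo]. *)
Lemma profile_of_volume n (V : R) : (2 <= n)%N -> 0 < V ->
  exists2 f, profile f & leb (@body R n f) = V%:E.
Proof.
move=> n2 V0; have m0 : (0 < n.-1)%N by case: n n2 => [|[]].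
have m0' : (0 : R) < n.-1%:R by rewrite ltr0n.
(* This radius makes the cross-section volume [w] exceed [V], so the half-length [V / (2w)] fits in
   the strip. *)
pose r := n.-1%:R * (1 + V); have r0 : 0 <= r by rewrite mulr_ge0//; lra.
have [w wE rw] := int_rV_ball_fin m0 r0.
have Vw : V < w.
  apply: lt_le_trans rw; rewrite /r mulrAC mulfV ?mul1r ?gt_eqF//.
  apply: (@lt_le_trans _ _ (1 + V)); first by rewrite ltrDr.
  by rewrite -[leLHS]expr1 ler_weXn2l//; lra.
have w0 : 0 < w by exact: lt_trans Vw.
pose a := V / (w + w).
have a0 : 0 <= a by rewrite divr_ge0//; lra.
have a2 : a <= 2^-1 by rewrite ler_pdivrMr; lra.
pose f (t : R) : \bar R := if `|t| <= a then r%:E else 0%E.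
have pf : profile f.
  split=> [t _|]; first by rewrite /f; case: ifP => // _; rewrite lee_fin.
  split=> [t _|b c b0 bc c2]; first by rewrite /f normrN.
  have c0 := le_trans b0 bc.
  rewrite /f !ger0_norm//; case: (leP c a) => ca; last by case: ifP; rewrite ?lee_fin.
  by rewrite (le_trans bc ca).
exists f => //; rewrite /leb /int_Rn.
pose I := `[- a, a]%classic : set R.
have E t : int_rV (fun v => (\1_(@body R n f) (t, v))%:E) =
    (w%:E * (\1_I t)%:E)%E.
  have [tI|tI] := pselect (I t).
    rewrite [\1_I t]indicE mem_set// mule1 -wE; congr int_rV; apply/funext => v.
    have ta : `|t| <= a by move: tI; rewrite /I /= in_itv/= ler_norml.
    congr (_%:R%:E); congr nat_of_bool; apply/idP/idP => /set_mem.
      by move=> [_ /=]; rewrite /f ta lee_fin => ?; exact/mem_set.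
    move=> /= vr; apply/mem_set; split => /=; last by rewrite /f ta lee_fin.
    by rewrite -ler_norml (le_trans ta).
  rewrite [\1_I t]indicE memNset// mule0.
  have ta : (`|t| <= a) = false.
    by apply/negP => ta; apply: tI; rewrite /I /= in_itv/= -ler_norml.
  apply/eqP; rewrite eq_le iint_ge0 ?andbT; last by move=> v; rewrite lee_fin.
  (* Off [[-a, a]] the profile is 0 and the slice is at most the origin, a sphere of radius 0. *)
  rewrite -[leRHS](@int_rV_sphere R n.-1 0%E m0).
  apply: le_iint => v; first by rewrite lee_fin.
  rewrite lee_fin !indicE.
  have [/set_mem [_ /=]|_] := boolP (_ \in body f); last by rewrite ler0n.
  rewrite /f ta lee_fin => v0; rewrite mem_set//=; congr EFin.
  by apply/eqP; rewrite eq_le v0 eucl_ge0.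
under eq_integral do rewrite E.
have mI : measurable I by exact: measurable_itv.
rewrite integralZ_indic ?lee_fin ?ltW//.
rewrite /I lebesgue_measure_itv/= lte_fin.
have a0' : 0 < a by rewrite divr_gt0//; lra.
have -> : - a < a by lra.
rewrite -EFinB -EFinM; congr EFin; rewrite /a; field.
by rewrite gt_eqF//; lra.
Qed.

End geometry.

(** * Selection and semicontinuity *)

Section selection.

(* A free ultrafilter decides every predicate of the family at once, and
   meeting finitely many of its members at each step gives the subsequence. *)
Lemma eventually_constant_subseq (I : countType) (c : I -> nat -> bool) :
  exists phi : nat -> nat, (forall k, (k <= phi k)%N) /\
    forall i, exists b, \forall k \near \oo, c i (phi k) = b.
Proof.
have [U [UU ooU]] := ultraFilterLemma eventually_filter.
have FU : ProperFilter U by exact: ultra_proper.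
pose b i := `[< U [set k | c i k] >].
have Ub i : U [set k | c i k = b i].
  have [Uc|Uc] := in_ultra_setVsetC [set k | c i k] UU.
    have -> : b i = true by apply/asboolP.
    exact: Uc.
  have -> : b i = false.
    apply/asboolPn => Uc'; have [k []] := filter_ex (filterI Uc Uc').
    by [].
  by apply: filterS Uc => k /= /negP/negbTE.
(* At [phi N] all predicates of code below [N] already take the value chosen by the ultrafilter. *)
have [phi Hphi] : {phi : nat -> nat & forall N, (N <= phi N)%N /\
    forall i, (pickle i < N)%N -> c i (phi N) = b i}.
  apply: (@choice _ _ (fun N k => (N <= k)%N /\
    forall i, (pickle i < N)%N -> c i k = b i)) => N.
  suff : U ([set k | (N <= k)%N] `&`
      [set k | forall i, (pickle i < N)%N -> c i k = b i]) by exact: filter_ex.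
  apply: filterI; first by apply: ooU; exact: nbhs_infty_ge.
  elim: N => [|N IH]; first exact: filterE.
  case E : (@pickle_inv I N) => [i|]; last first.
    apply: filterS IH => k kb j; rewrite ltnS leq_eqVlt => /orP[/eqP jN|/kb//].
    by move: E; rewrite -jN pickleK_inv.
  apply: filterS (filterI IH (Ub i)) => k [kb ki] j.
  rewrite ltnS leq_eqVlt => /orP[/eqP jN|/kb//].
  by move: E; rewrite -jN pickleK_inv => -[->].
exists phi; split=> [k|i]; first by case: (Hphi k).
exists (b i); exists (pickle i).+1 => // k ik.
by have [_] := Hphi k; apply.
Qed.

End selection.

(** * The limit profile and convergence of the bodies off a null set *)

Section limit_profile.
Variables (R : realType) (f : nat -> R -> \bar R).
Hypothesis pf : forall k, profile (f k).
Hypothesis fcst : forall q p : rat,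
  exists b, \forall k \near \oo, ((ratr p)%:E < f k (ratr q))%E = b.

(** The pointwise lower limit, written with eventual lower bounds so that evenness and monotony pass
    to it directly. *)
Definition lim_profile (t : R) : \bar R :=
  ereal_sup [set x | \forall k \near \oo, (x <= f k t)%E].

Lemma profile_lim : profile lim_profile.
Proof.
split=> [t tS|].
  apply: ereal_sup_ubound; apply: nearW => k.
  by have [f0 _] := pf k; exact: f0.
split=> [t tS|a b a0 ab b2].
  congr ereal_sup; apply/seteqP; split => x /=; apply: filterS => k;
    by have [_ [fN _]] := pf k; rewrite fN.
apply: ereal_sup_le => x /=; apply: filterS => k /le_trans; apply.
by have [_ [_ fd]] := pf k; exact: fd.
Qed.

Definition oscillates_at (p : rat) : set R :=
  [set t | -(2^-1) <= t <= 2^-1 /\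
    ~ (\forall k \near \oo, f k t <= (ratr p)%:E)%E /\
    ~ (\forall k \near \oo, (ratr p)%:E <= f k t)%E].

(** If [|t| < |t'|], take a rational [q] between them. Eventually [f k q] stays on one side of [p];
    by monotony so does [f k t] if it is above, or [f k t'] if it is not. *)
Lemma oscillates_at_norm p t t' :
  oscillates_at p t -> oscillates_at p t' -> `|t'| <= `|t|.
Proof.
move=> [tS [_ tp]] [tS' [tp' _]]; rewrite leNgt; apply/negP => tt'.
have [q] := rat_in_itvoo tt'; rewrite in_itv/= => /andP[tq qt'].
have q0 : (0 : R) <= ratr q by exact: le_trans (ltW tq).
have t2 : `|t'| <= 2^-1 by rewrite ler_norml.
have qS : -(2^-1) <= (ratr q : R) <= 2^-1.
  by rewrite -ler_norml ger0_norm// (le_trans (ltW qt')).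
have [[] bq] := fcst q p.
  apply: tp; apply: filterS bq => k pq; apply: (le_trans (ltW pq)).
  by apply: profile_le => //; rewrite (ger0_norm q0) ltW.
apply: tp'; apply: filterS bq => k /negbT; rewrite -leNgt; apply: le_trans.
by apply: profile_le => //; rewrite (ger0_norm q0) ltW.
Qed.

Definition oscillation : set R := \bigcup_(p in [set: rat]) oscillates_at p.

(** Each rational level accounts for at most two points, which share one absolute value. *)
Lemma countable_oscillation : countable oscillation.
Proof.
apply: bigcup_countable => // p _.
have [[t tp]|tp] := pselect (exists t, oscillates_at p t); last first.
  rewrite (_ : oscillates_at p = set0)//; apply/seteqP; split => // t pt.
  by apply: tp; exists t.
apply: (@sub_countable _ _ _ [set t; - t]); last exact: finite_set_countable.
apply: subset_card_le => t' tp'.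
have /eqP : `|t'| = `|t|.
  by apply/eqP; rewrite eq_le !(oscillates_at_norm (p := p)).
by rewrite eqr_norm2 => /orP[]/eqP ->; [left|right].
Qed.

Definition exceptional n : set (pt R n) :=
  [set x | oscillation x.1 \/ (eucl x.2)%:E = strip_ext lim_profile x.1].

Lemma measurable_exceptional n :
  measurable (@exceptional n : set (mpt R n)).
Proof.
by apply: measurable_graph; [exact: profile_lim|exact: countable_oscillation].
Qed.

Lemma leb_exceptional n : (2 <= n)%N -> leb (@exceptional n) = 0%E.
Proof. by move=> n2; apply: leb_graph_null => //; exact: countable_oscillation. Qed.

(** Off the exceptional set the radius differs from the limit profile. If it is smaller, some
    eventual lower bound exceeds it. If it is larger, a rational in between is not an eventual lower
    bound, hence is an eventual upper bound by absence of oscillation. *)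
Lemma body_lim n (x : pt R n) : ~ exceptional x ->
  \forall k \near \oo, body (f k) x <-> body lim_profile x.
Proof.
move=> xN; have [xS|xS] := boolP (-(2^-1) <= x.1 <= 2^-1); last first.
  by apply: nearW => k; split => -[]; rewrite (negbTE xS).
have xD p : ~ oscillates_at p x.1 by move=> ?; apply: xN; left; exists p.
have [rf|] := ltP (eucl x.2)%:E (lim_profile x.1).
  have [y /= ky ry] := ereal_sup_gt rf.
  apply: filterS ky => k yk; split => _; split => //; first exact: (ltW rf).
  exact: le_trans (ltW ry) yk.
rewrite le_eqVlt => /orP[/eqP fr|fr].
  by exfalso; apply: xN; right; rewrite /strip_ext xS.
have [p /andP[fp pr]] := ereal_rat_between fr.
have : \forall k \near \oo, (f k x.1 <= (ratr p)%:E)%E.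
  apply: contrapT => H; apply: (xD p); split => //; split => // H'.
  have : ((ratr p)%:E <= lim_profile x.1)%E by exact: ereal_sup_ubound.
  by rewrite leNgt fp.
apply: filterS => k fk; split => -[_ xf]; exfalso; move: xf.
  by apply/negP; rewrite -ltNge (le_lt_trans fk).
by apply/negP; rewrite -ltNge.
Qed.

End limit_profile.

(** * Lower semicontinuity of volume and perimeter *)

Section semicontinuity.
Variables (R : realType) (n : nat).

Lemma limn_einf_le (u : nat -> \bar R) (a C : \bar R) :
  (\forall k \near \oo, u k <= C)%E -> (a <= limn_einf u)%E -> (a <= C)%E.
Proof.
move=> uC /le_limn_einfP au; rewrite leNgt; apply/negP.
move=> /ereal_rat_between[q /andP[Cq qa]].
have [k [uk qk]] := filter_ex (filterI uC (au _ qa)).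
by have := le_trans qk uk; rewrite leNgt Cq.
Qed.

Variable N : set (pt R n).
Hypothesis mN : measurable (N : set (mpt R n)).
Hypothesis N0 : leb N = 0%E.

(** The one-sided hypothesis serves both for the bodies and for their complements in a box. *)
Lemma leb_le_limn_einf (E : set (pt R n)) (E_ : nat -> set (pt R n)) :
  (forall k, measurable (E_ k : set (mpt R n))) ->
  (forall x, ~ N x -> E x -> \forall k \near \oo, E_ k x) ->
  (leb E <= limn_einf (fun k => leb (E_ k)))%E.
Proof.
move=> mE EE; apply: (fatou_int_Rn_null mN N0
  (f := fun k x => (\1_(E_ k) x)%:E)) => [k|k x|x|x xN].
- exact: measurable_indicE.
- exact: indicE_ge0.
- exact: indicE_ge0.
- apply/le_limn_einfP => c.
  have [/set_mem xE|xE] := boolP (x \in E); rewrite indicE.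
    rewrite mem_set// => c1; apply: filterS (EE x xN xE) => k xk.
    by rewrite indicE mem_set// ltW.
  rewrite (negbTE xE) => c0; apply: nearW => k.
  exact: le_trans (ltW c0) (indicE_ge0 _ _).
Qed.

(** Fatou's lemma is used twice: for the density at every [y], then for its integral over the
    body. *)
Lemma PS_le_limn_einf (s : R) (F : set (pt R n)) (F_ : nat -> set (pt R n)) :
  measurable (F : set (mpt R n)) ->
  (forall k, measurable (F_ k : set (mpt R n))) ->
  (forall x, ~ N x -> \forall k \near \oo, F_ k x <-> F x) ->
  (PS s F <= limn_einf (fun k => PS s (F_ k)))%E.
Proof.
move=> mF mF_ FF.
have inner y : (interaction s F y <= limn_einf (fun k => interaction s (F_ k) y))%E.
  apply: (fatou_int_Rn_null mN N0 (f := fun k x =>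
    (\1_(@strip R n `\` F_ k) x)%:E * Kern s (ptsub x y))%E) => [k|k x|x|x xN].
  - exact: measurable_interaction_fun.
  - by rewrite mule_ge0 ?indicE_ge0 ?Kern_ge0.
  - by rewrite mule_ge0 ?indicE_ge0 ?Kern_ge0.
  - apply/le_limn_einfP => c cK; apply: filterS (FF x xN) => k xk.
    apply: (le_trans (ltW cK)); rewrite le_eqVlt; apply/orP; left.
    apply/eqP; congr (_%:R%:E * _)%E; congr nat_of_bool.
    by apply/idP/idP => /set_mem[xS xF]; apply/mem_set; split => // /xk.
apply: (fatou_int_Rn_null mN N0 (f := fun k y =>
  (\1_(F_ k `&` @strip R n) y)%:E * interaction s (F_ k) y)%E) => [k|k y|y|y yN].
- exact: measurable_PS_fun.
- by rewrite mule_ge0 ?indicE_ge0 ?interaction_ge0.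
- by rewrite mule_ge0 ?indicE_ge0 ?interaction_ge0.
- apply/le_limn_einfP => c.
  have [/set_mem[yF yS]|yF] := boolP (y \in F `&` @strip R n); rewrite indicE.
    rewrite mem_set// mul1e => cK.
    have /le_limn_einfP/(_ _ cK) cK' := inner y.
    apply: filterS (filterI (FF y yN) cK') => k [[_ yk] ck].
    by rewrite indicE mem_set ?mul1e//; split => //; exact: yk.
  rewrite (negbTE yF) mul0e => c0; apply: nearW => k.
  by rewrite (le_trans (ltW c0))// mule_ge0 ?indicE_ge0 ?interaction_ge0.
Qed.

Lemma leb_split (A B : set (pt R n)) : measurable (A : set (mpt R n)) ->
  measurable (B : set (mpt R n)) ->
  leb A = (leb (A `&` B) + leb (A `\` B))%E.
Proof.
move=> mA mB; rewrite -lebU.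
- by congr leb; rewrite setUIDK.
- exact: measurableI.
- exact: measurableD.
- by rewrite setIDA; apply/seteqP; split => // x [[[_ xB] _]].
Qed.

End semicontinuity.

(** * Conservation of volume in the limit *)

Section volume.
Variables (R : realType) (n : nat).

(** Fatou's lemma on the bodies bounds the limit only from above, so it is applied to their
    complements in a box [B] of volume [W]. Tightness bounds these by [W - V + eps]; the limit
    inherits the bound and so fills at least [V - eps] of [B]. *)
Lemma leb_lim_ge (s V A : R) (N F : set (pt R n)) (f : nat -> R -> \bar R) :
  (2 <= n)%N -> 0 < s -> 0 < V ->
  measurable (N : set (mpt R n)) -> leb N = 0%E ->
  measurable (F : set (mpt R n)) ->
  (forall k, profile (f k)) ->
  (forall k, leb (@body R n (f k)) = V%:E) ->
  (forall k, (PS s (@body R n (f k)) <= A%:E)%E) ->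
  (forall x, ~ N x -> \forall k \near \oo, @body R n (f k) x <-> F x) ->
  (V%:E <= leb F)%E.
Proof.
move=> n2 s0 V0 mN N0 mF pf fV fA fF; apply/lee_addgt0Pr => eps eps0.
have [r r0 tail] := tail_volume_small A n2 s0 V0 eps0.
pose B := @box R n (-(2^-1)) 2^-1 (const_mx (- r)) (r + r).
have mB : measurable (B : set (mpt R n)) by exact: measurable_box.
pose W : R := (2^-1 - -(2^-1)) * (r + r) ^+ n.-1.
have lebB : leb B = W%:E by apply: leb_box; lra.
(* Volumes inside the box are finite, so the balance of volumes can be computed in [R]. *)
have fin (E : set (pt R n)) : E `<=` B -> leb E = (fine (leb E))%:E.
  move=> EB; rewrite fineK// ge0_fin_numE.
    by rewrite (le_lt_trans (le_leb EB))// lebB ltry.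
  by apply: int_Rn_ge0 => x; exact: indicE_ge0.
have mBf k : measurable (@body R n (f k) : set (mpt R n)) by exact: measurable_body.
have out k : (leb (B `\` body (f k)) <= (W - V + eps)%:E)%E.
  have le1 : (leb (body (f k) `\` B) <= eps%:E)%E.
    apply: le_trans (tail (f k) (pf k) (fV k) (fA k)).
    apply: le_leb => x [xf xB]; split => //=; rewrite ltNge; apply/negP => xr.
    apply: xB; split; first by case: xf.
    move=> i; rewrite !mxE addrA addNr add0r -ler_norml.
    exact: le_trans (coord_le_eucl _ i) xr.
  have e1 := leb_split (mBf k) mB.
  have e2 := leb_split mB (mBf k).
  move: e1 e2; rewrite fV lebB [B `&` _]setIC.
  have := fin (body (f k) `&` B) (@subIsetr _ _ _).
  have := fin (B `\` body (f k)) (@subDsetl _ _ _).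
  set a := fine _; set b := fine _ => -> ->.
  have c0 : (0 <= leb (body (f k) `\` B))%E.
    by apply: int_Rn_ge0 => x; exact: indicE_ge0.
  move: le1 c0; case: (leb (body (f k) `\` B)) => // c.
  rewrite !lee_fin -!EFinD => ceps c0 [->] [->].
  lra.
have inF : (leb (B `\` F) <= (W - V + eps)%:E)%E.
  apply: (@limn_einf_le R (fun k => leb (B `\` body (f k)))).
    by apply: nearW => k; exact: out.
  apply: (leb_le_limn_einf mN N0) => [k|x xN [xB xF]].
    exact: measurableD.
  by apply: filterS (fF x xN) => k xk; split => // /xk.
have := leb_split mB mF; rewrite lebB.
have EF := fin (B `&` F) (@subIsetl _ _ _).
have ED := fin (B `\` F) (@subDsetl _ _ _).
move: inF; rewrite EF ED -EFinD lee_fin => inF [WE].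
have le2 : (leb (B `&` F) <= leb F)%E by apply: le_leb; exact: subIsetr.
apply: (@le_trans _ _ (leb (B `&` F) + eps%:E)%E); last exact: leeD2r.
rewrite EF -EFinD lee_fin; move: inF WE.
set a := fine _; set b := fine _ => inF WE.
by rewrite WE in inF; lra.
Qed.

End volume.

(** * Minimizing sequences and existence of a minimizer *)

Lemma near_infty_natSinv_le (R : realType) (e : R) : 0 < e ->
  \forall k \near \oo, k.+1%:R^-1 <= e.
Proof. by move=> e0; apply: filterS (near_infty_natSinv_lt (PosNum e0)) => k /ltW. Qed.

Unset Implicit Arguments.

Theorem theorem1p1 (R : realType) (n : nat) (s : R) :
  (2 <= n)%N -> 0 < s < 1 ->
  forall mu : R, 0 < mu ->
  exists Fs : set (pt R n),
    inK Fs /\ leb Fs = mu%:E /\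
    (forall F : set (pt R n), inK F -> leb F = mu%:E -> (PS s Fs <= PS s F)%E).
Proof.
move=> n2 /andP[s0 _] V V0.
pose adm := [set f : R -> \bar R | profile f /\ leb (@body R n f) = V%:E].
pose I := ereal_inf [set PS s (@body R n f) | f in adm].
suff [f [pf fV fI]] : exists f, [/\ profile f, leb (@body R n f) = V%:E &
    (PS s (@body R n f) <= I)%E].
  exists (body f); split; first by apply/inKP; exists f.
  split; first exact: fV.
  move=> F /inKP[g pg ->] gV.
  apply: (le_trans fI).
  by apply: ereal_inf_lbound; exists g.
have PS0 F : (0 <= PS s F :> \bar R)%E.
  by apply: int_Rn_ge0 => y; rewrite mule_ge0 ?indicE_ge0 ?interaction_ge0.
have I0 : (0 <= I)%E by apply: le_ereal_inf_tmp => _ [f _ <-].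
(* If the infimum is [+oo], any admissible body is a minimizer. *)
have [Ioo|Ifin] := eqVneq I +oo%E.
  have [f pf fV] := profile_of_volume n2 V0.
  by exists f; split; rewrite // Ioo leey.
have {}Ifin : I \is a fin_num by rewrite ge0_fin_numE// ltey.
have /choice[f Hf] k : exists f, [/\ profile f, leb (@body R n f) = V%:E &
    (PS s (@body R n f) <= I + k.+1%:R^-1%:E)%E].
  have k0 : (0 : R) < k.+1%:R^-1 by rewrite invr_gt0.
  have [_ [f [pf fV] <-] fI] := lb_ereal_inf_adherent k0 Ifin.
  by exists f; split => //; exact: ltW.
(* The predicates compare the profiles at rational points with rational levels, a countable
   family. *)
have [phi [kphi phiP]] := eventually_constant_subseq
  (fun (qp : rat * rat) k => ((ratr qp.2)%:E < f k (ratr qp.1))%E).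
pose g k := f (phi k).
have pg k : profile (g k) by case: (Hf (phi k)).
have gV k : leb (@body R n (g k)) = V%:E by case: (Hf (phi k)).
have gI k : (PS s (@body R n (g k)) <= I + k.+1%:R^-1%:E)%E.
  (* The rate survives the extraction because [phi k >= k]. *)
  have [_ _ /le_trans] := Hf (phi k); apply; rewrite leeD2l// lee_fin.
  by rewrite lef_pV2 ?posrE// ler_nat ltnS.
have gcst (q p : rat) : exists b, \forall k \near \oo,
    ((ratr p)%:E < g k (ratr q))%E = b by exact: (phiP (q, p)).
have ph := profile_lim pg.
have mN : measurable (@exceptional R g n : set (mpt R n)).
  exact: measurable_exceptional.
have N0 : leb (@exceptional R g n) = 0%E by exact: leb_exceptional.
have cv (x : pt R n) : ~ exceptional g x ->
    \forall k \near \oo, body (g k) x <-> body (lim_profile g) x.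
  exact: body_lim.
have mh : measurable (@body R n (lim_profile g) : set (mpt R n)).
  exact: measurable_body.
exists (lim_profile g); split=> //.
  apply/eqP; rewrite eq_le; apply/andP; split.
    apply: (@limn_einf_le R (fun k => leb (@body R n (g k)))).
      by apply: nearW => k; rewrite gV.
    apply: (leb_le_limn_einf mN N0) => [k|x xN xh].
      exact: measurable_body.
    by apply: filterS (cv x xN) => k xk; apply/xk.
  (* All perimeters are at most the infimum plus 1, since [1 / (k+1) <= 1]. *)
  apply: (leb_lim_ge (A := fine I + 1) n2 s0 V0 mN N0 mh pg gV _ cv) => k.
  apply: le_trans (gI k) _.
  by rewrite EFinD fineK// leeD2l// lee_fin invf_le1// ler1n.
apply/lee_addgt0Pr => e e0.
apply: (@limn_einf_le R (fun k => PS s (@body R n (g k)))).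
  apply: filterS (near_infty_natSinv_le e0) => k ke.
  by apply: le_trans (gI k) _; rewrite leeD2l.
by apply: (PS_le_limn_einf mN N0) => // k; exact: measurable_body.
Qed.
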